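(* There exists $n_0$ such that for every integer $n\ge n_0$ and every positive integer $b\le\left(1-\frac{30}{\ln^{1/4}n}\right)\frac{n}{\ln n}$, Maker has a strategy to win the $(1:b)$ Maker-Breaker Hamiltonicity game played on the edge set of the complete graph $K_n$ within at most $14n$ of his moves.
   Context: In the $(1:b)$ Maker-Breaker game on the edge set of $K_n$, two players, Maker and Breaker, alternately claim previously unclaimed edges of $K_n$; Breaker moves first and claims $b$ edges per turn, Maker claims $1$ edge per turn (if fewer edges remain than a player should claim, he claims all remaining ones). In the Hamiltonicity game, Maker wins if the graph on the vertex set of $K_n$ formed by his claimed edges contains a Hamilton cycle; Breaker wins otherwise. *)

(* Defs.v *)
From mathcomp Require Import all_boot.
From Stdlib Require Import Reals.
Set Implicit Arguments. Unset Strict Implicit. Unset Printing Implicit Defensive.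

(* Vertices of K_n are 'I_n; an edge is a 2-element subset of 'I_n.
   A board position is given by Maker's edge set M and Breaker's edge set B. *)
Definition Kn_edges (n : nat) : {set {set 'I_n}} :=
  [set e : {set 'I_n} | #|e| == 2].

Definition free_edges (n : nat) (M B : {set {set 'I_n}}) : {set {set 'I_n}} :=
  Kn_edges n :\: (M :|: B).

Definition has_ham_cycle (n : nat) (M : {set {set 'I_n}}) : Prop :=
  exists s : seq 'I_n,
    [/\ 3 <= size s, size s = n, uniq s &
        cycle (fun x y => [set x; y] \in M) s].

Definition breaker_move (n b : nat) (M B X : {set {set 'I_n}}) : Prop :=
  X \subset free_edges M B /\ #|X| = minn b #|free_edges M B|.

(* maker_wins_within n b k M B : in the position (M, B) with Breaker to move,
   Maker has a strategy guaranteeing that his graph contains a Hamilton cycle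
   after at most k further Maker moves, against every Breaker play.
   (If no free edge remains when Maker must move, he cannot move and the game
   is over, so Maker has not won.) *)
Fixpoint maker_wins_within (n b k : nat) (M B : {set {set 'I_n}}) : Prop :=
  has_ham_cycle M \/
  match k with
  | 0 => False
  | k'.+1 =>
      forall X, breaker_move b M B X ->
        exists e, e \in free_edges M (B :|: X) /\
                  maker_wins_within b k' (e |: M) (B :|: X)
  end.

(* Main.v *)
From Stdlib Require Import Reals Lra.
From mathcomp Require Import all_boot all_order all_algebra.
From mathcomp Require Import boolp Rstruct zify.
From mathcomp Require ring lra.
Require Import Defs.
Import Order.TTheory GRing.Theory Num.Theory.
Set Implicit Arguments. Unset Strict Implicit. Unset Printing Implicit Defensive.

(** Maker plays in three stages.

    First each vertex [v] chooses 12 edges: Maker serves the vertex with less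
    than 12 choices of largest danger [deg v - 2 (b + 1) #choices], where [deg]
    counts the claimed edges of both players.  An average over the dangers of
    the vertices still to be served shows that, when it is served, [v] has at
    least about [n / ln^(1/4) n] free edges.  A random free edge at each step
    would produce an expander; Maker instead picks an edge that does not
    increase the conditional expectation of the number of sets [X] all of
    whose choices lie in a set of size [3 #|X|].  As this expectation is less
    than 1 at the start, every set of at most [k0 = 6 n / sqrt (ln n)] vertices
    ends with more than twice as many neighbours.

    Then at most [n] moves join the component of a fixed vertex to its
    complement, and at most [n] moves claim an edge joining the ends of a
    longest path (Posa's rotations).  In both cases there are [(k0 + 1)^2]
    ordered pairs to choose from, more than twice the number of edges that
    Breaker claims in [14 n] moves. *)

(** * Rotations and longest paths *)

Definition upath (T : eqType) (e : rel T) (p : seq T) := uniq p && sorted e p.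

Definition longest (T : eqType) (e : rel T) (p : seq T) :=
  upath e p /\ forall q, upath e q -> size q <= size p.

Definition nbhd (T : finType) (e : rel T) (U : {set T}) :=
  [set w | (w \notin U) && [exists u in U, e u w]].

(* Strict inequality, so that the neighbours of a set along a path may be
   counted as if the path were closed into a cycle. *)
Definition expander (T : finType) (e : rel T) (k : nat) :=
  forall U : {set T}, 0 < #|U| <= k -> 2 * #|U| < #|nbhd e U|.

(** Posa rotations with the first vertex fixed: the edge from the last vertex [u] back to [w]
    reverses everything after [w]. An empty [c] changes nothing. *)
Inductive rotation (T : eqType) (e : rel T) (p0 : seq T) : seq T -> Prop :=
| RotRefl : rotation e p0 p0
| RotStep a w c u : rotation e p0 (a ++ w :: rcons c u) -> e u w ->
    rotation e p0 (a ++ w :: u :: rev c).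

(** Serves both for the edges of the graph and for the relation that records adjacency on [p0]. *)
Lemma sorted_rotate (T : Type) (R : rel T) a w c u :
  symmetric R -> sorted R (a ++ w :: rcons c u) -> R u w ->
  sorted R (a ++ w :: u :: rev c).
Proof.
move=> symR; rewrite !sorted_cat_cons => /andP[-> /= sc] Ruw.
rewrite symR Ruw /=.
have : sorted R (rev (rcons c u)).
  rewrite rev_sorted (@eq_sorted _ _ R); last by move=> x y; rewrite symR.
  exact: path_sorted sc.
by rewrite rev_rcons.
Qed.

Lemma rotation_upath (T : eqType) (e : rel T) p0 p :
  symmetric e -> upath e p0 -> rotation e p0 p -> upath e p.
Proof.
move=> syme up0; elim=> // a w c u _ /andP[Up sp] euw.
apply/andP; split; last exact: sorted_rotate.
rewrite -(@perm_uniq _ (a ++ w :: rcons c u)) //.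
by rewrite perm_cat2l perm_cons -rev_rcons perm_sym perm_rev.
Qed.

Lemma rotation_size (T : eqType) (e : rel T) p0 p :
  rotation e p0 p -> size p = size p0.
Proof.
elim=> // a w c u _ <- _.
by rewrite !size_cat /= size_rcons size_rev.
Qed.

Lemma rotation_head (T : eqType) (e : rel T) x p0 p :
  rotation e p0 p -> head x p = head x p0.
Proof. by elim=> // -[|y a] w c u _ <- _. Qed.

Definition rot_ends (T : finType) (e : rel T) (p0 : seq T) : {set T} :=
  [set u | `[< exists p, rotation e p0 (rcons p u) >]].

Lemma longest_neighbour_mem (T : eqType) (e : rel T) p u w :
  longest e (rcons p u) -> e u w -> w \in rcons p u.
Proof.
move=> [/andP[Up sp] maxp] euw; apply/negPn/negP => wNp.
have /maxp : upath e (rcons (rcons p u) w).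
  apply/andP; split; first by rewrite rcons_uniq wNp.
  by rewrite -!cats1 -catA sorted_cat_cons sp /= euw.
by rewrite size_rcons ltnn.
Qed.

Definition cyc_adj (T : eqType) (p : seq T) : rel T :=
  fun y z => (z == next p y) || (y == next p z).

Definition cyc_nbhd (T : finType) (p : seq T) (S : {set T}) : {set T} :=
  (next p @: S) :|: (prev p @: S).

Lemma cyc_adj_nbhd (T : finType) (p : seq T) (S : {set T}) w s :
  uniq p -> s \in S -> cyc_adj p w s -> w \in cyc_nbhd p S.
Proof.
move=> Up sS /orP[/eqP E|/eqP->]; rewrite inE; last by rewrite imset_f.
by apply/orP; right; apply/imsetP; exists s; rewrite // E prev_next.
Qed.

Lemma card_cyc_nbhd (T : finType) (p : seq T) (S : {set T}) :
  #|cyc_nbhd p S| <= 2 * #|S|.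
Proof.
apply: leq_trans (leq_card_setU _ _) _; rewrite mul2n -addnn.
by apply: leq_add; apply: leq_imset_card.
Qed.

Lemma rotation_last_end (T : finType) (e : rel T) p0 p u :
  rotation e p0 (rcons p u) -> u \in rot_ends e p0.
Proof. by move=> rp; rewrite inE; apply/asboolP; exists p. Qed.

Lemma rotation_step_end (T : finType) (e : rel T) p0 a w c u :
  rotation e p0 (a ++ w :: rcons c u) -> e u w ->
  head u c \in rot_ends e p0.
Proof.
move=> rp euw; have := RotStep rp euw.
case: c {rp} => [|h c] /= rp.
  by apply: (@rotation_last_end _ _ _ (a ++ [:: w])); rewrite rcons_cat.
apply: (@rotation_last_end _ _ _ (a ++ w :: u :: rev c)).
by rewrite rcons_cat /= -rev_cons.
Qed.

(* The neighbourhood on the path of a vertex that is neither an endpoint of a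
   rotation nor next on [p0] to such an endpoint is never changed. *)
Lemma rotation_preserves_adj (T : finType) (e : rel T) p0 p :
  uniq p0 -> rotation e p0 p ->
  let bad := rot_ends e p0 :|: cyc_nbhd p0 (rot_ends e p0) in
  sorted (fun y z => (y \notin bad) || (z \notin bad) ==> cyc_adj p0 y z) p.
Proof.
move=> Up0 rp /=; set bad := _ :|: _.
set R := (R in sorted R _).
have symadj : symmetric (cyc_adj p0) by move=> y z; rewrite /cyc_adj orbC.
have symR : symmetric R by move=> y z; rewrite /R orbC symadj.
elim: rp => [|a w c u rp IH euw].
  have : sorted (frel (next p0)) p0.
    have := cycle_next Up0; case: (p0) => //= x q.
    by rewrite rcons_path => /andP[].
  apply: sub_sorted => y z /= /eqP yz; rewrite /R; apply/implyP => _.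
  by rewrite /cyc_adj yz eqxx.
apply: sorted_rotate => //.
have uS : u \in rot_ends e p0.
  by apply: (@rotation_last_end _ _ _ (a ++ w :: c)); rewrite rcons_cat.
have hS := rotation_step_end rp euw.
have Rwh : R w (head u c).
  move: IH; rewrite sorted_cat_cons => /andP[_].
  by case: (c) => [|h c'] /= /andP[].
(* The only new consecutive pair is [u], [w], and [u] is an end. Were [w] good, its old link to
   [head u c] would come from [p0], and this being an end, [w] would be bad. *)
rewrite /R; apply/implyP => /orP[|wNbad].
  by rewrite inE uS.
move: Rwh; rewrite /R wNbad /= => adjwh.
by case/negP: wNbad; rewrite inE orbC (cyc_adj_nbhd Up0 hS adjwh).
Qed.

(** Posa's lemma. Maximality puts a neighbour [w] of an end on the rotated path, and one more
    rotation makes the successor of [w] an end. Were [w] not next to an end on [p0], its links would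
    be those of [p0], so the new end would be next to it there. *)
Lemma nbhd_rot_ends (T : finType) (e : rel T) p0 :
  symmetric e -> longest e p0 ->
  nbhd e (rot_ends e p0) \subset cyc_nbhd p0 (rot_ends e p0).
Proof.
move=> syme [up0 max0]; have /andP[Up0 _] := up0.
apply/subsetP => w; rewrite inE => /andP[wNS /existsP[u /andP[uS euw]]].
move: (uS); rewrite inE => /asboolP[p rp].
have lp : longest e (rcons p u).
  split; first exact: rotation_upath rp.
  by move=> q /max0; rewrite (rotation_size rp).
have := longest_neighbour_mem lp euw.
rewrite mem_rcons inE; case: eqVneq => [E|_ /= wp]; first by rewrite E uS in wNS.
case/splitPr: p / wp rp lp => a c; rewrite rcons_cat rcons_cons => rp _.
have hS := rotation_step_end rp euw.
apply/negPn/negP => wN.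
have /= := rotation_preserves_adj Up0 rp; rewrite sorted_cat_cons => /andP[_].
have wNbad : w \notin rot_ends e p0 :|: cyc_nbhd p0 (rot_ends e p0).
  by rewrite inE negb_or wNS.
have -> : rcons c u = head u c :: behead (rcons c u) by case: (c).
move=> /= /andP[]; rewrite wNbad /= => adjwh _.
by case/negP: wN; apply: cyc_adj_nbhd adjwh.
Qed.

(** With at most [k] ends, expansion would give them more than twice as many neighbours, against the
    two per end in [cyc_nbhd]. Rotations keep the head [x]. *)
Lemma posa (T : finType) (e : rel T) k x p0 :
  symmetric e -> expander e k -> longest e (x :: p0) ->
  exists S : {set T}, k < #|S| /\
    forall u, u \in S -> exists p,
      [/\ upath e (x :: p), size p = size p0 & last x p = u].
Proof.
move=> syme exp_e lp; exists (rot_ends e (x :: p0)); split.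
  rewrite ltnNge; apply/negP => Sk.
  have S0 : 0 < #|rot_ends e (x :: p0)|.
    apply/card_gt0P; exists (last x p0).
    apply: (@rotation_last_end _ _ _ (belast x p0)); rewrite -lastI.
    exact: RotRefl.
  have := exp_e (rot_ends e (x :: p0)); rewrite S0 Sk => /(_ isT).
  have := subset_leq_card (nbhd_rot_ends syme lp).
  by move=> nS lt_nS; have := leq_trans lt_nS (leq_trans nS (card_cyc_nbhd _ _));
    rewrite ltnn.
move=> u; rewrite inE => /asboolP[q rq].
have uq := rotation_upath syme lp.1 rq.
have sq := rotation_size rq; have hq := rotation_head x rq.
case: q {rq} uq sq hq => [|y q] /= uq.
  by move=> [s0] ux; exists [::]; rewrite /= in uq; rewrite -ux.
move=> [sq] yx; exists (rcons q u); rewrite last_rcons -yx; split=> //.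
Qed.

(** * Boosters and connectivity *)

Lemma upath_size (T : finType) (e : rel T) p : upath e p -> size p <= #|T|.
Proof. by move=> /andP[/card_uniqP <- _]; apply: max_card. Qed.

Lemma exists_longest (T : finType) (e : rel T) p :
  upath e p -> exists q, longest e q /\ size p <= size q.
Proof.
have [m] := ubnP (#|T| - size p); elim: m p => // m IH p lt_m up.
have [[q [uq lt_pq]]|Nq] := EM (exists q, upath e q /\ size p < size q).
  have := upath_size uq => leq_qT.
  have /IH/(_ uq)[r [lr le_qr]] : #|T| - size q < m by lia.
  by exists r; split; rewrite ?(leq_trans (ltnW lt_pq)).
exists p; split=> //; split=> // q uq; rewrite leqNgt; apply/negP => lt_pq.
by apply: Nq; exists q.
Qed.

Lemma crossing_edge (T : finType) (e : rel T) (S : {set T}) x y :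
  symmetric e -> connect e x y -> x \in S -> y \notin S ->
  exists u v, [/\ u \in S, v \notin S & e u v].
Proof.
move=> syme cxy xS yNS; apply: contrapT => Nuv.
have clS : closed e (mem S).
  move=> u v euv; apply/idP/idP => [uS|vS]; apply/negPn/negP => N; apply: Nuv.
    by exists u, v.
  by exists v, u; split; rewrite // syme.
by have := closed_connect clS cxy; rewrite xS (negbTE yNS).
Qed.

(** Some edge leaves the cycle; opening the cycle where it is attached and prepending the outside
    vertex gains one vertex. *)
Lemma cycle_extend (T : finType) (e : rel T) s :
  symmetric e -> (forall x y, connect e x y) -> uniq s -> cycle e s ->
  0 < size s < #|T| -> exists q, upath e q /\ size q = (size s).+1.
Proof.
move=> syme conn Us cs /andP[s0 sT].
have /existsP[z zNs] : [exists z, z \notin s].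
  rewrite -negb_forall; apply/negP => /forallP all_s.
  have : #|T| <= size s.
    rewrite -(card_uniqP Us); apply: subset_leq_card.
    by apply/subsetP => y _; apply: all_s.
  by rewrite leqNgt sT.
have [x xs] : exists x, x \in s by case: (s) s0 => // y t _; exists y; rewrite inE eqxx.
have [u [v [us vNs euv]]] : exists u v, [/\ u \in s, v \notin s & e u v].
  have := @crossing_edge _ e [set y in s] x z syme (conn x z).
  rewrite !inE => /(_ xs zNs)[u [v [us vNs euv]]].
  by exists u, v; rewrite !inE in us vNs.
have [i t Et] := rot_to us.
exists (v :: u :: t); split; last by rewrite /= -(size_rot i s) Et.
apply/andP; split.
  by rewrite cons_uniq -Et mem_rot vNs rot_uniq.
by move: cs; rewrite -(rot_cycle i) Et /= rcons_path [e v u]syme euv => /andP[-> _].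
Qed.

Definition adj (n : nat) (M : {set {set 'I_n}}) : rel 'I_n :=
  fun x y => [set x; y] \in M.

Lemma adj_sym n (M : {set {set 'I_n}}) : symmetric (adj M).
Proof. by move=> x y; rewrite /adj setUC. Qed.

Lemma adj_mono n (M M' : {set {set 'I_n}}) :
  M \subset M' -> subrel (adj M) (adj M').
Proof. by move=> /subsetP sM x y; apply: sM. Qed.

Lemma expander_mono n (M M' : {set {set 'I_n}}) k :
  M \subset M' -> expander (adj M) k -> expander (adj M') k.
Proof.
move=> sM exM U /exM lt; apply: leq_trans lt _; apply: subset_leq_card.
apply/subsetP => w; rewrite !inE => /andP[-> /existsP[u /andP[uU uw]]].
by apply/existsP; exists u; rewrite uU (adj_mono sM).
Qed.

Lemma connect_mono n (M M' : {set {set 'I_n}}) x y :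
  M \subset M' -> connect (adj M) x y -> connect (adj M') x y.
Proof.
move=> sM; apply: connect_sub => u v uv; apply: connect1; exact: adj_mono uv.
Qed.

Definition deg (n : nat) (C : {set {set 'I_n}}) (v : 'I_n) : nat :=
  #|[set e in C | v \in e]|.

Lemma sum_deg n (X : {set {set 'I_n}}) (J : {set 'I_n}) :
  X \subset Kn_edges n -> \sum_(v in J) deg X v <= 2 * #|X|.
Proof.
move=> /subsetP sX.
apply: (@leq_trans (\sum_v deg X v)).
  by rewrite [leqRHS](bigID (mem J)) /= leq_addr.
under eq_bigr => v _ do rewrite /deg -sum1dep_card big_mkcondr.
rewrite exchange_big /= mulnC -sum_nat_const leq_sum // => e eX.
rewrite -big_mkcond sum1_card.
by have := sX _ eX; rewrite inE => /eqP->.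
Qed.

Lemma set2_inj n (v : 'I_n) : {in [pred w | w != v] &, injective (fun w => [set v; w])}.
Proof.
move=> x y; rewrite !inE => xv yv /setP/(_ x).
by rewrite !inE eqxx orbT (negbTE xv) /= => /esym/eqP.
Qed.

Lemma card_adj_le_deg n (C : {set {set 'I_n}}) (v : 'I_n) :
  #|[set w | (w != v) && adj C v w]| <= deg C v.
Proof.
rewrite -(@card_in_imset _ _ (fun w => [set v; w])); last first.
  by move=> x y; rewrite !inE => /andP[xv _] /andP[yv _]; apply: set2_inj.
apply: subset_leq_card; apply/subsetP => e /imsetP[w].
by rewrite !inE => /andP[_ vw] ->; apply/andP; split=> //; rewrite !inE eqxx.
Qed.

(** If no such pair were free, all of them would be Breaker's, and the degrees in [B] over [S] would
    add up to at least [k.+1 ^ 2], whereas each edge of [B] counts at most twice there. *)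
Lemma free_pair n k (M B : {set {set 'I_n}}) (S : {set 'I_n})
    (T : 'I_n -> {set 'I_n}) :
  B \subset Kn_edges n -> 2 * #|B| < k.+1 ^ 2 -> k < #|S| ->
  (forall u, u \in S -> k < #|T u|) ->
  (forall u t, u \in S -> t \in T u -> t != u /\ ~~ adj M u t) ->
  exists u t, [/\ u \in S, t \in T u & [set u; t] \in free_edges M B].
Proof.
move=> sB ltB kS kT NM; apply: contrapT => Nfree.
suff : k.+1 ^ 2 <= 2 * #|B| by rewrite leqNgt ltB.
apply: leq_trans (sum_deg S sB).
rewrite -mulnn; apply: (@leq_trans (#|S| * k.+1)); first by rewrite leq_mul2r kS orbT.
rewrite -sum_nat_const; apply: leq_sum => u uS.
apply: leq_trans (kT u uS) (leq_trans _ (card_adj_le_deg _ _)).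
apply: subset_leq_card; apply/subsetP => t tT; rewrite inE.
have [tu NMut] := NM u t uS tT; rewrite tu /=.
apply/negPn/negP => NB; apply: Nfree; exists u, t; split=> //.
rewrite in_setD in_setU negb_or; apply/andP; split; first exact/andP.
by rewrite inE cards2 [u == t]eq_sym tu.
Qed.

Lemma longer_or_ham n (M : {set {set 'I_n}}) u p :
  3 <= n -> (forall x y, connect (adj M) x y) ->
  upath (adj M) (u :: p) -> adj M (last u p) u ->
  has_ham_cycle M \/ exists q, upath (adj M) q /\ size q = (size p).+2.
Proof.
move=> n3 conn up lu; have /andP[Up sp] := up.
have cyc : cycle (adj M) (u :: p) by rewrite /= rcons_path lu andbT.
have := upath_size up; rewrite card_ord leq_eqVlt => /orP[/eqP szn|lt_n].
  by left; exists (u :: p); split; rewrite ?szn.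
have [|q [uq sq]] := cycle_extend (@adj_sym n M) conn Up cyc.
  by rewrite card_ord.
by right; exists q.
Qed.

Lemma longest_ends_ham n (M : {set {set 'I_n}}) u p :
  3 <= n -> (forall x y, connect (adj M) x y) ->
  longest (adj M) (u :: p) -> adj M (last u p) u -> has_ham_cycle M.
Proof.
move=> n3 conn [up maxp] lu.
have [//|[q [/maxp + sq]]] := longer_or_ham n3 conn up lu.
by rewrite sq ltnn.
Qed.

Lemma upath_mono n (M M' : {set {set 'I_n}}) p :
  M \subset M' -> upath (adj M) p -> upath (adj M') p.
Proof.
by move=> sM /andP[Up sp]; rewrite /upath Up (sub_sorted (adj_mono sM)).
Qed.

Lemma upath_rev (T : eqType) (e : rel T) p :
  symmetric e -> upath e (rev p) = upath e p.
Proof.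
move=> syme; rewrite /upath rev_uniq rev_sorted.
by congr andb; apply: eq_sorted => x y; rewrite syme.
Qed.

(** [posa] is applied twice: it gives more than [k] ends [u] for the fixed start, then, with the
    path reversed, more than [k] ends [t] for each [u]. A free pair among them closes a longest path
    into a cycle. *)
Lemma booster n k (M B : {set {set 'I_n}}) p :
  3 <= n -> 0 < k -> B \subset Kn_edges n -> 2 * #|B| < k.+1 ^ 2 ->
  expander (adj M) k -> (forall x y, connect (adj M) x y) ->
  ~ has_ham_cycle M -> longest (adj M) p -> 0 < size p ->
  exists2 e, e \in free_edges M B & has_ham_cycle (e |: M) \/
    exists q, upath (adj (e |: M)) q /\ size q = (size p).+1.
Proof.
move=> n3 k0 sB ltB exM conn NH; case: p => // x p lp _.
have [S [kS PS]] := posa (@adj_sym n M) exM lp.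
pose ends u t := exists q,
  [/\ upath (adj M) (u :: q), size q = size p & last u q = t].
pose T u := [set t | `[< ends u t >]].
have longest_of u q : upath (adj M) (u :: q) -> size q = size p ->
    longest (adj M) (u :: q).
  by move=> uq sq; split=> // r /lp.2; rewrite /= sq.
have kT u : u \in S -> k < #|T u|.
  move=> uS; have [q [uq sq lq]] := PS u uS.
  pose q' := rev (belast x q).
  have Eq : rev (x :: q) = u :: q' by rewrite lastI rev_rcons lq.
  have uq' : upath (adj M) (u :: q') by rewrite -Eq upath_rev //; apply: adj_sym.
  have sq' : size q' = size p by rewrite size_rev size_belast.
  have [S' [kS' PS']] := posa (@adj_sym n M) exM (longest_of _ _ uq' sq').
  apply: leq_trans kS' _; apply: subset_leq_card; apply/subsetP => t tS'.
  have [r [ur sr lr]] := PS' t tS'.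
  by rewrite inE; apply/asboolP; exists r; rewrite sr sq'.
have [|u [t [uS tT free_e]]] := free_pair sB ltB kS kT (M := M).
  move=> u t uS tT; move: (tT); rewrite inE => /asboolP[q [uq sq lq]]; split.
    (* A path from [u] to itself has one vertex. Then all longest paths have one vertex and [T u]
       has at most one element, against [0 < k < #|T u|]. *)
    apply/eqP => tu; have q0 : q = [::].
      case: q uq sq lq => // y q /andP[/= /andP[uNq _] _] _ lq.
      by rewrite -tu -lq mem_last in uNq.
    have p0 : size p = 0 by rewrite -sq q0.
    have := kT u uS; rewrite ltnNge; case/negP.
    apply: leq_trans k0; rewrite -(cards1 u); apply: subset_leq_card.
    apply/subsetP => y; rewrite !inE => /asboolP[r [_ sr <-]].
    by rewrite p0 in sr; rewrite (size0nil sr).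
  apply/negP => ut; apply: NH; apply: (longest_ends_ham n3 conn (longest_of _ _ uq sq)).
  by rewrite lq adj_sym.
exists [set u; t] => //.
move: tT; rewrite inE => /asboolP[q [uq sq lq]].
have sM : M \subset [set u; t] |: M := subsetUr _ _.
have conn' y z : connect (adj ([set u; t] |: M)) y z by apply: connect_mono (conn y z).
have lu : adj ([set u; t] |: M) (last u q) u by rewrite /adj lq !inE setUC eqxx.
by have := longer_or_ham n3 conn' (upath_mono sM uq) lu; rewrite sq.
Qed.

(** * Maker's last two stages: connecting the graph, then lengthening paths *)

Lemma wins_of_ham n b k (M B : {set {set 'I_n}}) :
  has_ham_cycle M -> maker_wins_within b k M B.
Proof. by case: k => [|k] hM; left. Qed.

Lemma breaker_move_bound n b (M B X : {set {set 'I_n}}) :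
  B \subset Kn_edges n -> breaker_move b M B X ->
  B :|: X \subset Kn_edges n /\ #|B :|: X| <= #|B| + b.
Proof.
move=> sB [sX cX]; split.
  by rewrite subUset sB (subset_trans sX) // subsetDl.
apply: leq_trans (leq_card_setU _ _) _.
by rewrite leq_add2l cX geq_minl.
Qed.

(** Each Maker move lengthens a longest path by one or finishes a Hamilton cycle, and [b * r]
    reserves the edges that Breaker may still claim. At [r = 0] the path would have more than [n]
    vertices. *)
Lemma extend_path_stage n b k r (M B : {set {set 'I_n}}) :
  3 <= n -> 0 < k -> B \subset Kn_edges n ->
  2 * (#|B| + b * r) < k.+1 ^ 2 ->
  expander (adj M) k -> (forall x y, connect (adj M) x y) ->
  (exists p, upath (adj M) p /\ n < size p + r) ->
  maker_wins_within b r M B.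
Proof.
move=> n3 k0; elim: r M B => [|r IH] M B sB ltB exM conn [p [up ltp]].
  have := upath_size up; rewrite card_ord => le_n.
  by move: ltp; rewrite addn0 ltnNge le_n.
have [HM|NH] := EM (has_ham_cycle M); first exact: wins_of_ham.
right=> X mX; have [sBX cBX] := breaker_move_bound sB mX.
have [q [lq le_pq]] := exists_longest up.
have q0 : 0 < size q.
  have v0 : 'I_n by case: (n) n3 => // m _; apply: ord0.
  exact: (lq.2 [:: v0]).
have [|e free_e He] :=
    booster (B := B :|: X) n3 k0 sBX _ exM conn NH lq q0.
  by apply: leq_ltn_trans ltB; lia.
exists e; split=> //.
have sM : M \subset e |: M := subsetUr _ _.
case: He => [|[s [us ss]]]; first exact: wins_of_ham.
apply: IH => //.
- by apply: leq_ltn_trans ltB; lia.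
- exact: expander_mono exM.
- by move=> x y; apply: connect_mono (conn x y).
- exists s; split=> //; rewrite ss.
  by rewrite addSnnS (leq_trans ltp) // leq_add2r.
Qed.

Lemma component_card n k (M : {set {set 'I_n}}) (S : {set 'I_n}) :
  expander (adj M) k -> S != set0 ->
  (forall u w, u \in S -> adj M u w -> w \in S) -> k < #|S|.
Proof.
move=> exM S0 clS; rewrite ltnNge; apply/negP => Sk.
have := exM S; rewrite card_gt0 S0 Sk => /(_ isT).
suff -> : nbhd (adj M) S = set0 by rewrite cards0.
apply/setP => w; rewrite !inE; apply/negP => /andP[wNS /existsP[u /andP[uS uw]]].
by rewrite (clS u w uS uw) in wNS.
Qed.

Lemma wins_mono n b k (M B : {set {set 'I_n}}) :
  maker_wins_within b k M B -> maker_wins_within b k.+1 M B.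
Proof.
elim: k M B => [|k IH] M B; first by case=> //; left.
case=> [|W]; first by left.
by right=> X /W[e [free_e We]]; exists e; split=> //; apply: IH.
Qed.

(** The component of [v0] and its complement are closed under adjacency, so both exceed [k] and
    [free_pair] finds an edge joining them. Once the component is everything, a one-vertex path
    starts the last [n] moves. *)
Lemma connect_stage n b k r (v0 : 'I_n) (M B : {set {set 'I_n}}) :
  3 <= n -> 0 < k -> B \subset Kn_edges n ->
  2 * (#|B| + b * (r + n)) < k.+1 ^ 2 ->
  expander (adj M) k ->
  n <= #|[set y | connect (adj M) v0 y]| + r ->
  maker_wins_within b (r + n) M B.
Proof.
move=> n3 k0; elim: r M B => [|r IH] M B sB ltB exM; set C := [set y | _] => leC.
  have CT y : connect (adj M) v0 y.
    suff : y \in C by rewrite inE.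
    suff -> : C = setT by rewrite inE.
    apply/eqP; rewrite eqEcard subsetT cardsT card_ord.
    by rewrite addn0 in leC.
  apply: (extend_path_stage n3 k0) => //.
    move=> x y; apply: connect_trans (CT y).
    by rewrite (sym_connect_sym (@adj_sym n M)).
  by exists [:: v0]; split=> //; rewrite /= add1n.
(* A surplus move is discarded, so that [gt_C] makes the complement of [C] nonempty. *)
have [le_C|gt_C] := leqP n (#|C| + r).
  apply: wins_mono; apply: IH => //.
  by apply: leq_ltn_trans ltB; lia.
right=> X mX; have [sBX cBX] := breaker_move_bound sB mX.
have clC u w : adj M u w -> (u \in C) = (w \in C).
  move=> uw; rewrite !inE; apply/idP/idP => c; apply: connect_trans c _.
    exact: connect1.
  by rewrite (sym_connect_sym (@adj_sym n M)); apply: connect1.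
have kC : k < #|C|.
  apply: component_card exM _ _; last by move=> u w uC /clC <-.
  by apply/set0Pn; exists v0; rewrite inE connect0.
have kC' : k < #|~: C|.
  apply: component_card exM _ _; last first.
    by move=> u w uC /clC E; move: uC; rewrite !in_setC E.
  rewrite -card_gt0 -(ltn_add2l #|C|) addn0 cardsC card_ord.
  exact: leq_ltn_trans (leq_addr r _) gt_C.
have [|||u [t [uC tC free_e]]] :=
    @free_pair n k M (B :|: X) C (fun=> ~: C) sBX _ kC; first by lia.
- by [].
- move=> u t uC; rewrite in_setC => tC; split.
    by apply: contraNneq tC => ->.
  by apply/negP => /clC; rewrite uC (negbTE tC).
exists [set u; t]; split=> //.
have sM : M \subset [set u; t] |: M := subsetUr _ _.
apply: IH => //; first by lia.
  exact: expander_mono exM.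
apply: leq_trans leC _; rewrite addnS -addSn leq_add2r.
apply: proper_card; apply/properP; split.
  by apply/subsetP => y; rewrite !inE; apply: connect_mono.
exists t; last by rewrite in_setC in tC.
rewrite inE; apply: (connect_trans (y := u)).
  by rewrite inE in uC; apply: connect_mono uC.
by apply: connect1; rewrite /adj !inE eqxx.
Qed.

(** * The degree game *)

Section OrderedFields.
Import ring lra.

Definition touching (n : nat) (C : {set {set 'I_n}}) (J : {set 'I_n}) : nat :=
  #|[set e in C | e :&: J != set0]|.

Lemma deg_setU n (C X : {set {set 'I_n}}) v :
  deg (C :|: X) v <= deg C v + deg X v.
Proof.
apply: leq_trans (leq_card_setU _ _); apply: subset_leq_card.
by apply/subsetP => e; rewrite !inE andb_orl.
Qed.

Lemma touching_setU n (C X : {set {set 'I_n}}) J :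
  touching (C :|: X) J <= touching C J + #|X|.
Proof.
apply: leq_trans (leq_card_setU _ _); apply: subset_leq_card.
by apply/subsetP => e; rewrite !inE => /andP[/orP[->|->] ->]; rewrite ?orbT.
Qed.

Lemma touching_le_sum n (C : {set {set 'I_n}}) (J : {set 'I_n}) :
  touching C J <= \sum_(v in J) deg C v.
Proof.
rewrite /deg; under eq_bigr => v _ do rewrite -sum1dep_card big_mkcondr.
rewrite exchange_big /= /touching -sum1dep_card big_mkcondr /=.
apply: leq_sum => e eC; case: ifP => // /set0Pn[v]; rewrite inE => /andP[ve vJ].
by rewrite (bigD1 v) //= ve.
Qed.

Lemma touching1 n (C : {set {set 'I_n}}) v : touching C [set v] = deg C v.
Proof.
apply: eq_card => e; rewrite !inE; congr andb.
apply/set0Pn/idP => [[w]|ve]; first by rewrite !inE => /andP[we /eqP <-].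
by exists v; rewrite !inE ve eqxx.
Qed.

(** The edges counted twice on the left join [v] to [J], so there are at most [#|J|] of them. *)
Lemma touching_add n (C : {set {set 'I_n}}) (J : {set 'I_n}) v :
  C \subset Kn_edges n -> v \notin J ->
  touching C J + deg C v <= touching C (v |: J) + #|J|.
Proof.
move=> /subsetP sC vNJ.
rewrite /touching /deg -cardsUI; apply: leq_add.
  apply: subset_leq_card; apply/subsetP => e.
  rewrite !inE -andb_orr => /andP[-> /= /orP[/set0Pn[w]|ve]].
    rewrite inE => /andP[we wJ]; apply/set0Pn.
    by exists w; rewrite !inE we wJ orbT.
  by apply/set0Pn; exists v; rewrite !inE ve eqxx.
apply: leq_trans (leq_imset_card (fun w => [set v; w]) J).
apply: subset_leq_card; apply/subsetP => e.
rewrite !inE => /andP[/andP[eC /set0Pn[w]]]; rewrite inE => /andP[we wJ].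
move=> /andP[_ ve]; apply/imsetP; exists w => //; apply/eqP.
have vw : v != w by apply: contraNneq vNJ => ->.
rewrite eq_sym eqEcard cards2 vw; have := sC _ eC; rewrite inE => /eqP->.
by rewrite andbT; apply/subsetP => z; rewrite !inE => /orP[]/eqP->.
Qed.

Local Open Scope ring_scope.

(** A turn of [b] edges adds at most [2 * b] to a sum of degrees, which one new choice in the set
    offsets. Later [b] stands for Breaker's bias plus Maker's own edge. *)
Definition danger (F : realFieldType) (n b : nat) (C : {set {set 'I_n}})
    (c : 'I_n -> nat) (v : 'I_n) : F :=
  (deg C v)%:R - 2 * b%:R * (c v)%:R.

(* Edges with both ends in [J] are counted twice in the sum of the dangers and
   once in [touching C J]; the second count is what saves a factor 2 in the
   bias for small [J]. *)
Definition danger_inv (F : realFieldType) (n b k : nat) (h g : nat -> F)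
    (C : {set {set 'I_n}}) (c : 'I_n -> nat) : Prop :=
  forall J : {set 'I_n}, J != set0 -> (forall v, v \in J -> c v < 12)%N ->
    ((k <= #|J|)%N -> \sum_(v in J) danger F b C c v <= #|J|%:R * h #|J|) /\
    ((#|J| <= k)%N -> (touching C J)%:R - 2 * b%:R * \sum_(v in J) (c v)%:R
                      <= #|J|%:R * g #|J|).

(** The recurrences come from comparing [J] with [v |: J] when the served [v] is outside [J]; the 1
    pays for [touching_add]. [h k <= g k] links the two ranges, and the last two conditions cover
    the first turn. *)
Definition danger_bounds (F : realFieldType) (n b k : nat) (h g : nat -> F) :=
  [/\ (forall j, (0 < j)%N -> (k <= j < n)%N -> h j.+1 + 2 * b%:R / j%:R <= h j),
      (forall j, (0 < j < k)%N -> g j.+1 + 1 + b%:R / j%:R <= g j),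
      h k <= g k,
      (forall j, (k <= j <= n)%N -> 2 * b%:R <= h j) &
      (forall j, (0 < j <= k)%N -> b%:R <= g j)].

Lemma sum_danger (F : realFieldType) n b (C : {set {set 'I_n}}) c (J : {set 'I_n}) :
  \sum_(v in J) danger F b C c v =
  (\sum_(v in J) deg C v)%:R - 2 * b%:R * \sum_(v in J) (c v)%:R.
Proof. by rewrite sumrB -natr_sum mulr_sumr. Qed.

Lemma touching_le_danger (F : realFieldType) n b (C : {set {set 'I_n}}) c
    (J : {set 'I_n}) :
  (touching C J)%:R - 2 * b%:R * \sum_(v in J) (c v)%:R <=
  \sum_(v in J) danger F b C c v.
Proof. by rewrite sum_danger lerD2r ler_nat touching_le_sum. Qed.

Lemma danger_inv_init (F : realFieldType) n b k h g (X : {set {set 'I_n}}) :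
  @danger_bounds F n b k h g -> X \subset Kn_edges n -> (#|X| <= b)%N ->
  danger_inv b k h g X (fun=> 0%N).
Proof.
move=> [_ _ _ hb gb] sX cX J J0 _.
have J1 : 1 <= #|J|%:R :> F by rewrite (ler_nat F 1) card_gt0.
have leJn : (#|J| <= n)%N by have := max_card (mem J); rewrite card_ord.
have b0 : 0 <= b%:R :> F by [].
split=> leJ.
  have hJ := hb _ (introT andP (conj leJ leJn)).
  rewrite sum_danger [X in _ * X]big1 // mulr0 subr0.
  have := sum_deg J sX; rewrite -(ler_nat F) natrM => le1.
  have le2 : #|X|%:R <= b%:R :> F by rewrite ler_nat.
  nra.
have gJ : b%:R <= g #|J| by apply: gb; rewrite card_gt0 J0.
rewrite big1 // mulr0 subr0.
have := touching_setU set0 X J; rewrite set0U -(ler_nat F).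
have -> : touching set0 J = 0%N.
  by apply/eqP; rewrite cards_eq0; apply/eqP/setP => e; rewrite !inE.
rewrite add0n => le1.
have le2 : #|X|%:R <= b%:R :> F by rewrite ler_nat.
nra.
Qed.

(** If [v] is in [J], its new choice offsets the claimed edges. Otherwise [v] has the largest
    danger, so the average over [J] is at most that over [v |: J], which the invariant bounds at
    size [#|J| + 1]. *)
Lemma danger_inv_step (F : realFieldType) n b k h g (C X : {set {set 'I_n}})
    (c : 'I_n -> nat) (v : 'I_n) :
  @danger_bounds F n b k h g -> C \subset Kn_edges n -> X \subset Kn_edges n ->
  (#|X| <= b)%N -> danger_inv b k h g C c -> (c v < 12)%N ->
  (forall u, (c u < 12)%N -> danger F b C c u <= danger F b C c v) ->
  danger_inv b k h g (C :|: X) (fun u => (u == v) + c u)%N.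
Proof.
move=> [hS gS hg _ _] sC sX cX inv cv max_v J J0 actJ.
have actJ' u : u \in J -> (c u < 12)%N.
  by move=> /actJ; apply: leq_ltn_trans; apply: leq_addl.
have [invD invT] := inv J J0 actJ'.
have j1 : 1 <= #|J|%:R :> F by rewrite (ler_nat F 1) card_gt0.
have b0 : 0 <= b%:R :> F by [].
have cXF : #|X|%:R <= b%:R :> F by rewrite ler_nat.
have sumc : \sum_(u in J) ((u == v) + c u)%:R =
    (v \in J)%:R + \sum_(u in J) (c u)%:R :> F.
  under eq_bigr => u _ do rewrite natrD.
  rewrite big_split /=; congr +%R; case: (boolP (v \in J)) => vJ.
    by rewrite (bigD1 v) //= eqxx big1 ?addr0 // => u /andP[_ /negbTE->].
  by rewrite big1 // => u uJ; case: eqVneq => // uv; rewrite -uv uJ in vJ.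
have sumD : \sum_(u in J) danger F b (C :|: X) (fun u => (u == v) + c u)%N u
    <= \sum_(u in J) danger F b C c u + 2 * b%:R - 2 * b%:R * (v \in J)%:R.
  rewrite !sum_danger sumc.
  have : (\sum_(u in J) deg (C :|: X) u <= \sum_(u in J) deg C u + 2 * #|X|)%N.
    apply: leq_trans (leq_add (leqnn _) (sum_deg J sX)).
    by rewrite -big_split /=; apply: leq_sum => u _; apply: deg_setU.
  rewrite -(ler_nat F) natrD natrM => le1.
  by rewrite mulrDr; nra.
have sumT : (touching (C :|: X) J)%:R <= (touching C J)%:R + b%:R :> F.
  rewrite -natrD ler_nat; apply: leq_trans (touching_setU _ _ _) _.
  by rewrite leq_add2l.
have [vJ|vNJ] := boolP (v \in J).
  rewrite vJ mulr1 in sumD; rewrite sumc vJ.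
  split=> leJ; first by apply: le_trans (invD leJ); lra.
  by apply: le_trans (invT leJ); rewrite mulrDr mulr1; lra.
have cardJv : #|v |: J| = #|J|.+1 by rewrite cardsU1 vNJ.
have J'0 : v |: J != set0 by rewrite -card_gt0 cardJv.
have actJv u : u \in v |: J -> (c u < 12)%N.
  by rewrite !inE => /orP[/eqP->|/actJ'].
have [] := inv (v |: J) J'0 actJv; rewrite cardJv => invD' invT'.
have ltJn : (#|J| < n)%N by have := max_card (mem (v |: J)); rewrite card_ord cardJv.
have avg : \sum_(u in J) danger F b C c u <= #|J|%:R * danger F b C c v.
  rewrite -sum1_card natr_sum mulr_suml; apply: ler_sum => u uJ.
  by rewrite mul1r max_v // actJ'.
have jn0 : #|J|%:R != 0 :> F by rewrite gt_eqF // (lt_le_trans ltr01 j1).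
have claimD : (k <= #|J|)%N ->
    \sum_(u in J) danger F b (C :|: X) (fun u => (u == v) + c u)%N u
      <= #|J|%:R * h #|J|.
  move=> leJ; rewrite (negbTE vNJ) mulr0 subr0 in sumD.
  have {}invD' := invD' (leqW leJ).
  rewrite big_setU1 //= -natr1 in invD'.
  have /= := hS #|J|; rewrite card_gt0 J0 leJ ltJn => /(_ isT isT) hJ.
  have : #|J|%:R * (h #|J|.+1 + 2 * b%:R / #|J|%:R) <= #|J|%:R * h #|J|.
    by rewrite ler_wpM2l // ler0n.
  rewrite mulrDr [_ * (_ / _)]mulrC divfK // => le3.
  move: invD' avg sumD le3.
  set S := \sum_(u in J) _; set S' := \sum_(u in J) _; set d := danger _ _ _ _ _.
  set x := #|J|%:R in j1 *; set y := h _; set z := h _ => invD' avg sumD le3.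
  have : (x + 1) * S <= (x + 1) * (x * y) by nra.
  rewrite ler_pM2l; last by lra.
  by lra.
split=> // leJ; rewrite sumc (negbTE vNJ) add0r.
(* At size [k] the set [v |: J] is beyond the range of [g], so the bound on degree sums is used
   instead. *)
have [eqJ|ltJ] := eqVneq #|J| k.
  apply: le_trans (_ : #|J|%:R * h #|J| <= _); last first.
    by rewrite ler_wpM2l ?ler0n // eqJ.
  have /claimD : (k <= #|J|)%N by rewrite eqJ.
  apply: le_trans; apply: le_trans (touching_le_danger _ _ _ _ _).
  by rewrite sumc (negbTE vNJ) add0r.
have {}ltJ : (#|J| < k)%N by rewrite ltn_neqAle ltJ.
have {}invT' := invT' ltJ.
rewrite big_setU1 //= -natr1 in invT'.
have := touching_add sC vNJ; rewrite -(ler_nat F) !natrD => addT.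
have := gS #|J|; rewrite card_gt0 J0 ltJ => /(_ isT) gJ.
have : #|J|%:R * (g #|J|.+1 + 1 + b%:R / #|J|%:R) <= #|J|%:R * g #|J|.
  by rewrite ler_wpM2l // ler0n.
rewrite 2!mulrDr mulr1 [_ * (_ / _)]mulrC divfK // => le3.
have avgT := le_trans (touching_le_danger F b C c J) avg.
move: invT' addT sumT avgT le3; rewrite /danger.
set T := (touching C J)%:R; set T' := (touching (_ :|: _) J)%:R.
set T2 := (touching C (_ |: _))%:R; set S := \sum_(u in J) _.
set x := #|J|%:R in j1 *; set y := g _; set z := g _; set d := (deg C v)%:R.
set cv' := (c v)%:R => invT' addT sumT avgT le3.
(* [T - 2 * b%:R * S] is at most [x] times the danger of [v], so [x] copies of the bound at [v |: J]
   control [x + 1] copies of it. *)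
have : (x + 1) * (T - 2 * b%:R * S) <= (x + 1) * (x * y + x) by nra.
rewrite ler_pM2l; last by lra.
by lra.
Qed.

Lemma danger_inv_deg (F : realFieldType) n b k h g (C : {set {set 'I_n}}) c v :
  (0 < k)%N -> @danger_inv F n b k h g C c -> (c v < 12)%N ->
  (deg C v)%:R <= g 1%N + 22 * b%:R.
Proof.
move=> k0 inv cv; have [||_] := inv [set v].
- by rewrite -card_gt0 cards1.
- by move=> u; rewrite inE => /eqP->.
rewrite cards1 big_set1 touching1 mul1r => /(_ k0).
have : (c v)%:R <= 11 :> F by rewrite ler_nat.
have : 0 <= b%:R :> F by [].
by nra.
Qed.

(** * Expansion *)

Definition conf_weight (F : realFieldType) (n q : nat) (O : 'I_n -> {set 'I_n})
    (Z : {set 'I_n}) (v : 'I_n) : F :=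
  if O v \subset Z then (#|Z|%:R / q%:R) ^+ (12 - #|O v|) else 0.

(* If every vertex [v] draws each of its missing [12 - #|O v|] neighbours at
   random among [q] candidates, this bounds the expected number of pairs
   [X], [Z] with [#|Z| = 3 #|X|] and all choices made at [X] inside [Z]. *)
Definition conf_potential (F : realFieldType) (n q k : nat)
    (O : 'I_n -> {set 'I_n}) : F :=
  \sum_(i < k) \sum_(X : {set 'I_n} | #|X| == i.+1)
    \sum_(Z : {set 'I_n} | #|Z| == (3 * i.+1)%N) \prod_(v in X) conf_weight F q O Z v.

Definition add_choice (n : nat) (O : 'I_n -> {set 'I_n}) (v w : 'I_n) :=
  fun u => if u == v then w |: O u else O u.

Lemma conf_weight_ge0 (F : realFieldType) n q (O : 'I_n -> {set 'I_n}) Z v :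
  0 <= conf_weight F q O Z v.
Proof. by rewrite /conf_weight; case: ifP => // _; rewrite exprn_ge0 // divr_ge0. Qed.

(** Draws outside [Z] contribute 0, and the at most [#|Z|] others each remove one factor [#|Z| / q];
    [q <= #|Q|] balances the two. *)
Lemma sum_conf_weight (F : realFieldType) n q (O : 'I_n -> {set 'I_n})
    (Q Z : {set 'I_n}) v :
  (0 < q <= #|Q|)%N -> (#|O v| < 12)%N -> (forall w, w \in Q -> w \notin O v) ->
  \sum_(w in Q) conf_weight F q (add_choice O v w) Z v <=
  #|Q|%:R * conf_weight F q O Z v.
Proof.
move=> /andP[q0 qQ] Ov QO.
have p0 : 0 <= #|Z|%:R / q%:R :> F by rewrite divr_ge0.
set p := _ / _ in p0.
have [sOZ|NsOZ] := boolP (O v \subset Z); last first.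
  rewrite {2}/conf_weight (negbTE NsOZ) mulr0 big1 // => w _.
  by rewrite /conf_weight /add_choice eqxx subUset (negbTE NsOZ) andbF.
rewrite {2}/conf_weight sOZ -/p -(@subnSK #|O v|) // exprS mulrA.
apply: (@le_trans _ _ (\sum_(w in Z) p ^+ (11 - #|O v|))).
  rewrite [leRHS](bigID (mem Q)) /= [X in _ <= _ + X]big_mkcond /=.
  rewrite (bigID (mem Z)) /= addrC big1 ?add0r; last first.
    move=> w /andP[_ wNZ].
    by rewrite /conf_weight /add_choice eqxx subUset sub1set (negbTE wNZ).
  rewrite -[leLHS]addr0; apply: lerD.
    under eq_bigl => w do rewrite andbC.
    apply: ler_sum => w /andP[wZ wQ].
    rewrite /conf_weight /add_choice eqxx subUset sub1set wZ sOZ -/p cardsU1.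
    by rewrite QO // add1n.
  by apply: sumr_ge0 => w _; case: ifP => // _; apply: exprn_ge0.
rewrite sumr_const -[leLHS]mulr_natl ler_wpM2r ?exprn_ge0 //.
rewrite /p mulrCA ler_peMr // ler_pdivlMr ?ltr0n // mul1r ler_nat //.
Qed.

(** The method of conditional expectations: on average over [Q] the potential does not grow, since
    only the factor at [v] changes in each product. *)
Lemma conf_potential_step (F : realFieldType) n q k (O : 'I_n -> {set 'I_n})
    (Q : {set 'I_n}) v :
  (0 < q <= #|Q|)%N -> (#|O v| < 12)%N -> (forall w, w \in Q -> w \notin O v) ->
  exists2 w, w \in Q & conf_potential F q k (add_choice O v w) <=
                       conf_potential F q k O.
Proof.
move=> qQ Ov QO; apply: contrapT => Nw.
suff : \sum_(w in Q) conf_potential F q k (add_choice O v w) <=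
    #|Q|%:R * conf_potential F q k O.
  apply/negP; rewrite -ltNge mulr_natl -sumr_const.
  have /card_gt0P[w0 w0Q] : (0 < #|Q|)%N by case/andP: qQ; apply: leq_trans.
  apply: ltr_sum; first by apply/hasP; exists w0; rewrite ?mem_index_enum.
  by move=> w wQ; rewrite ltNge; apply/negP => le_w; apply: Nw; exists w.
rewrite /conf_potential exchange_big mulr_sumr; apply: ler_sum => i _.
rewrite exchange_big mulr_sumr; apply: ler_sum => X _.
rewrite exchange_big mulr_sumr; apply: ler_sum => Z _.
have same w u : u != v -> conf_weight F q (add_choice O v w) Z u = conf_weight F q O Z u.
  by move=> uv; rewrite /conf_weight /add_choice (negbTE uv).
have [vX|vNX] := boolP (v \in X); last first.
  rewrite mulr_natl -sumr_const; apply: ler_sum => w _.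
  rewrite le_eqVlt; apply/orP; left; apply/eqP; apply: eq_bigr => u uX.
  by apply: same; apply: contraNneq vNX => <-.
rewrite [X in _ <= _ * X](bigD1 v) //= mulrA.
have -> : \sum_(w in Q) \prod_(u in X) conf_weight F q (add_choice O v w) Z u =
    (\sum_(w in Q) conf_weight F q (add_choice O v w) Z v) *
    \prod_(u in X | u != v) conf_weight F q O Z u.
  rewrite mulr_suml; apply: eq_bigr => w _; rewrite (bigD1 v) //=; congr (_ * _).
  by apply: eq_bigr => u /andP[_ /same].
rewrite ler_wpM2r ?sum_conf_weight //.
by apply: prodr_ge0 => u _; apply: conf_weight_ge0.
Qed.

Lemma superset_of_card (T : finType) (A : {set T}) m :
  (#|A| <= m <= #|T|)%N -> exists2 Z : {set T}, A \subset Z & #|Z| = m.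
Proof.
move=> /andP[]; elim: m => [|m IH].
  by rewrite leqn0 => /eqP cA _; exists A; rewrite ?cA.
rewrite leq_eqVlt => /orP[/eqP cA _|]; first by exists A.
rewrite ltnS => /IH{}IH lt_m; have [Z sAZ cZ] := IH (ltnW lt_m).
have /set0Pn[x xZ] : ~: Z != set0.
  by rewrite -card_gt0 -(ltn_add2l #|Z|) addn0 cardsC cZ.
exists (x |: Z); first by rewrite subsetU // sAZ orbT.
by rewrite cardsU1 -in_setC xZ cZ.
Qed.

(** A violating [U] and its neighbours fit in a set [Z] of exactly [3 * #|U|] vertices, and the pair
    [U], [Z] contributes a product equal to 1. *)
Lemma expander_of_potential (F : realFieldType) n q k (O : 'I_n -> {set 'I_n})
    (M : {set {set 'I_n}}) :
  (3 * k <= n)%N -> (forall v, #|O v| = 12%N) ->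
  (forall v w, w \in O v -> adj M v w) ->
  conf_potential F q k O < 1 -> expander (adj M) k.
Proof.
move=> kn O12 OM lt1 U /andP[U0 Uk]; rewrite ltnNge; apply/negP => leN.
have [|Z sZ cZ] := @superset_of_card _ (U :|: nbhd (adj M) U) (3 * #|U|)%N.
  rewrite card_ord (leq_trans _ kn) ?leq_mul2l // andbT.
  apply: leq_trans (leq_card_setU _ _) _.
  by rewrite (mulSn 2) leq_add2l.
suff : 1 <= conf_potential F q k O by rewrite leNgt lt1.
have ltk : (#|U|.-1 < k)%N by rewrite prednK.
have pos X Z' : 0 <= \prod_(v in X) conf_weight F q O Z' v.
  by apply: prodr_ge0 => v _; apply: conf_weight_ge0.
rewrite /conf_potential (bigD1 (Ordinal ltk)) //= ler_wpDr //.
  by apply: sumr_ge0 => i _; apply: sumr_ge0 => X _; apply: sumr_ge0.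
rewrite (bigD1 U) ?prednK //= ler_wpDr //.
  by apply: sumr_ge0 => X _; apply: sumr_ge0.
rewrite (bigD1 Z) ?cZ ?eqxx //= ler_wpDr //; first exact: sumr_ge0.
rewrite big1 // => v vU; rewrite /conf_weight O12 subnn expr0 ifT //.
apply: subset_trans sZ; apply/subsetP => w /OM vw; rewrite !inE.
by case: (w \in U) => //=; apply/existsP; exists v; rewrite vU.
Qed.

(** * The initial value of the potential *)

Lemma binomial_bound n m : ('C(n, m) * m ^ m <= (4 * n) ^ m)%N.
Proof.
have ffact_ge j : (m ^ j <= (m + j) ^_ j)%N.
  by elim: j => // j IH; rewrite expnS addnS ffactSS leq_mul // leqW // leq_addr.
have ffact_le j : (n ^_ j <= n ^ j)%N.
  by elim: j => // j IH; rewrite ffactnSr expnSr leq_mul // leq_subr.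
have central : ('C(m + m, m) <= 4 ^ m)%N.
  rewrite -[4%N]/(2 ^ 2)%N -expnM mul2n -addnn -[X in (_ <= 2 ^ X)%N]card_ord.
  rewrite -cardsT -card_powerset -[X in 'C(X, _)]card_ord -card_draws.
  by apply: subset_leq_card; apply/subsetP => A _; rewrite powersetE subsetT.
apply: (@leq_trans ('C(n, m) * (4 ^ m * m`!))).
  rewrite leq_mul2l; apply/orP; right; apply: leq_trans (ffact_ge m) _.
  by rewrite -bin_ffact leq_mul2r central orbT.
by rewrite mulnCA bin_ffact expnMn leq_mul2l ffact_le orbT.
Qed.

(** Of [(3 * i) ^ (12 * i)], the factors [i ^ i] and [(3 * i) ^ (3 * i)] go to the two binomials and
    [(3 ^ 9 * i ^ 8) ^ i] remains. The factor [2 ^ i] yields a geometric series over the sizes. *)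
Lemma conf_potential_term n q k i :
  (2 * (4 * n) ^ 4 * 3 ^ 9 * k ^ 8 <= q ^ 12)%N -> (i <= k)%N ->
  (2 ^ i * ('C(n, i) * 'C(n, 3 * i) * (3 * i) ^ (12 * i)) <= q ^ (12 * i))%N.
Proof.
case: i => [|i] lt_q ik; first by rewrite !muln0 !expn0 !bin0.
rewrite [X in (_ <= X)%N]expnM; move: i.+1 (ltn0Sn i) ik => {}i i0 ik.
apply: (@leq_trans ((2 * (4 * n) ^ 4 * 3 ^ 9 * i ^ 8) ^ i)); last first.
  rewrite leq_exp2r //; apply: leq_trans lt_q.
  by rewrite leq_mul2l leq_exp2r // ik orbT.
have expand x y z w : ((x * y * z * w) ^ i = x ^ i * (y ^ i * (z ^ i * w ^ i)))%N.
  by rewrite !expnMn !mulnA.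
rewrite expand leq_mul2l; apply/orP; right.
have -> : (((4 * n) ^ 4) ^ i = (4 * n) ^ i * (4 * n) ^ (3 * i))%N.
  by rewrite -expnM -expnD; congr (_ ^ _)%N; lia.
have -> : ('C(n, i) * 'C(n, 3 * i) * (3 * i) ^ (12 * i) =
    ('C(n, i) * i ^ i) * ('C(n, 3 * i) * (3 * i) ^ (3 * i)) *
    ((3 ^ 9) ^ i * (i ^ 8) ^ i))%N.
  have E3 : (3 ^ (12 * i) = 3 ^ (3 * i) * (3 ^ 9) ^ i)%N.
    by rewrite -expnM -expnD -mulnDl.
  have Ei : (i ^ (12 * i) = i ^ i * i ^ (3 * i) * (i ^ 8) ^ i)%N.
    by rewrite -expnM -!expnD; congr (_ ^ _)%N; lia.
  rewrite !(expnMn 3 i) E3 Ei.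
  by move: (_ ^ i)%N (_ ^ i)%N (_ ^ i)%N (_ ^ (3 * i))%N => *; ring.
by rewrite leq_mul2r leq_mul ?orbT ?binomial_bound.
Qed.

Lemma conf_potential_init (F : realFieldType) n q k :
  (0 < q)%N -> (2 * (4 * n) ^ 4 * 3 ^ 9 * k ^ 8 <= q ^ 12)%N ->
  conf_potential F q k (fun _ : 'I_n => set0) < 1.
Proof.
move=> q0 lt_q.
have sum_half m : \sum_(i < m) (2^-1 ^+ i.+1 : F) < 1.
  suff -> : \sum_(i < m) (2^-1 ^+ i.+1 : F) = 1 - 2^-1 ^+ m.
    by rewrite ltrBlDr ltrDl exprn_gt0 // invr_gt0 ltr0n.
  elim: m => [|m IH]; first by rewrite big_ord0 expr0 subrr.
  by rewrite big_ord_recr IH /= exprS; field.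
apply: le_lt_trans (sum_half k); apply: ler_sum => i _.
have term (X Z : {set 'I_n}) : #|X| == i.+1 -> #|Z| == (3 * i.+1)%N ->
    \prod_(v in X) conf_weight F q (fun _ : 'I_n => set0) Z v =
    ((3 * i.+1)%:R / q%:R) ^+ (12 * i.+1).
  move=> /eqP cX /eqP cZ; rewrite /conf_weight sub0set cards0 subn0 cZ.
  by rewrite prodr_const cX exprM.
under eq_bigr => X cX do (under eq_bigr => Z cZ do rewrite (term X Z cX cZ)).
under eq_bigr => X _ do rewrite sumr_const.
rewrite sumr_const.
have cd m : #|[pred A : {set 'I_n} | #|A| == m]| = 'C(n, m).
  by rewrite -[n in RHS]card_ord -card_draws cardsE.
rewrite !cd -mulrnA expr_div_n -[leLHS]mulr_natl mulrA.
rewrite ler_pdivrMr ?exprn_gt0 ?ltr0n // exprVn ler_pdivlMl ?exprn_gt0 ?ltr0n //.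
rewrite -!natrX -!natrM ler_nat.
apply: leq_trans (conf_potential_term lt_q (ltn_ord i)).
by rewrite [('C(n, i.+1) * _)%N]mulnC.
Qed.

(** * Maker's first stage *)

Lemma max_danger_vertex (F : realFieldType) n b (C : {set {set 'I_n}})
    (c : 'I_n -> nat) v0 : (c v0 < 12)%N ->
  exists2 v, (c v < 12)%N &
    forall u, (c u < 12)%N -> danger F b C c u <= danger F b C c v.
Proof.
move=> act0; exists [arg max_(u > v0 | (c u < 12)%N) danger F b C c u]%O;
  by case: arg_maxP.
Qed.

Lemma card_free_nbrs n (C : {set {set 'I_n}}) v :
  (n <= #|[set w | (w != v) && ~~ adj C v w]| + deg C v + 1)%N.
Proof.
rewrite addnAC -leq_subLR; apply: leq_trans (card_adj_le_deg C v).
rewrite leq_subLR -{1}[n]card_ord -cardsT.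
set A := [set w | _ && ~~ _]; set A' := [set w | _].
have sT : setT \subset A :|: [set v] :|: A'.
  by apply/subsetP => w _; rewrite !inE; case: eqVneq; case: (adj C v w).
apply: leq_trans (subset_leq_card sT) _.
apply: leq_trans (leq_card_setU _ _) _; rewrite leq_add2r.
by apply: leq_trans (leq_card_setU _ _) _; rewrite cards1.
Qed.

(** [r] counts the missing choices. The invariant is assumed for every next move [X] of Breaker, so
    one step comprises Maker's edge and Breaker's reply, hence [b.+1]. *)
Lemma choice_stage (F : realFieldType) n b k q k0 (h g : nat -> F) r K
    (O : 'I_n -> {set 'I_n}) (M B : {set {set 'I_n}}) :
  danger_bounds n b.+1 k h g -> (0 < k)%N -> (0 < q)%N -> (3 * k0 <= n)%N ->
  g 1%N + 22 * b.+1%:R + q%:R + 1 <= n%:R ->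
  M \subset Kn_edges n -> B \subset Kn_edges n ->
  (forall v, #|O v| <= 12)%N -> (forall v w, w \in O v -> adj M v w) ->
  (\sum_v (12 - #|O v|) = r)%N ->
  (forall X : {set {set 'I_n}}, X \subset Kn_edges n -> (#|X| <= b)%N ->
     danger_inv b.+1 k h g (M :|: B :|: X) (fun v => #|O v|)) ->
  conf_potential F q k0 O < 1 ->
  (forall M' B' : {set {set 'I_n}}, B' \subset Kn_edges n ->
     (#|B'| <= #|B| + b * r)%N -> expander (adj M') k0 ->
     maker_wins_within b K M' B') ->
  maker_wins_within b (r + K) M B.
Proof.
move=> bnds k_gt0 q0 k0n numq.
elim: r O M B => [|r IH] O M B sM sB O12 OM sumO inv pot cont.
  apply: cont; rewrite ?muln0 ?addn0 //.
  apply: (expander_of_potential k0n _ OM pot) => v; apply/eqP.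
  rewrite eqn_leq O12 -subn_eq0.
  by move/eqP: sumO; rewrite sum_nat_eq0 => /forallP/(_ v).
right=> X mX; have [sBX cBX] := breaker_move_bound sB mX.
have [sXf cX] := mX.
have sX : X \subset Kn_edges n by apply: subset_trans sXf (subsetDl _ _).
have {}cX : (#|X| <= b)%N by rewrite cX geq_minl.
have {inv} := inv X sX cX; set C := M :|: B :|: X => inv.
have sC : C \subset Kn_edges n by rewrite !subUset sM sB.
have [v0 act0] : exists v0, (#|O v0| < 12)%N.
  apply: contrapT => Nact; have : (\sum_v (12 - #|O v|) = 0)%N.
    apply: big1 => v _; apply/eqP; rewrite subn_eq0 leqNgt; apply/negP => lt_v.
    by apply: Nact; exists v.
  by rewrite sumO.
have [v actv max_v] := @max_danger_vertex F n b.+1 C (fun v => #|O v|) v0 act0.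
pose Q := [set w | (w != v) && ~~ adj C v w].
have qQ : (0 < q <= #|Q|)%N.
  rewrite q0 /=; have := card_free_nbrs C v; rewrite -/Q.
  have := danger_inv_deg k_gt0 inv actv.
  rewrite -!(ler_nat F) !natrD; move: numq; lra.
have QO w : w \in Q -> w \notin O v.
  rewrite inE => /andP[_ vNw]; apply: contra vNw => /OM vw.
  by apply: adj_mono vw; rewrite /C -setUA subsetUl.
have [w wQ pot'] := conf_potential_step F k0 qQ actv QO.
move: (wQ); rewrite inE => /andP[wv vNw].
have eK : [set v; w] \in Kn_edges n by rewrite inE cards2 [v == w]eq_sym wv.
exists [set v; w]; split.
  by rewrite in_setD eK andbT setUA.
have sM' : M \subset [set v; w] |: M := subsetUr _ _.
have cardO' u : #|add_choice O v w u| = ((u == v) + #|O u|)%N.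
  by rewrite /add_choice; case: eqVneq => [->|//]; rewrite cardsU1 QO.
apply: (IH (add_choice O v w)) => //.
- by rewrite subUset sub1set eK.
- by move=> u; rewrite cardO'; case: eqVneq => [->|_]; rewrite ?add1n ?add0n.
- move=> u x; rewrite /add_choice; case: eqVneq => [->|_ /OM]; last exact: adj_mono.
  rewrite !inE => /orP[/eqP->|/OM]; first by rewrite /adj !inE eqxx.
  exact: adj_mono.
- apply/eqP; rewrite -eqSS -sumO; apply/eqP.
  rewrite (bigD1 v) //= [in RHS](bigD1 v) //= cardO' eqxx -addSn add1n subnSK //.
  by congr addn; apply: eq_bigr => u /negbTE uv; rewrite cardO' uv.
- move=> Y sY cY.
  have -> : [set v; w] |: M :|: (B :|: X) :|: Y = C :|: ([set v; w] |: Y).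
    by apply/setP => e; rewrite /C !inE; do !case: (_ \in _) => //=; rewrite ?orbT ?orbF.
  have -> : (fun u => #|add_choice O v w u|) = (fun u => ((u == v) + #|O u|)%N).
    by apply: funext => u; apply: cardO'.
  apply: danger_inv_step => //.
    by rewrite subUset sub1set eK.
  by apply: leq_trans (leq_card_setU _ _) _; rewrite cards1 add1n.
- exact: le_lt_trans pot' pot.
- move=> M' B' sB' cB'; apply: cont => //.
  by apply: leq_trans cB' _; rewrite mulnS addnA leq_add2r.
Qed.

Lemma maker_wins_of_params (F : realFieldType) n b k q k0 (h g : nat -> F) :
  danger_bounds n b.+1 k h g -> (0 < k)%N -> (0 < q)%N ->
  g 1%N + 22 * b.+1%:R + q%:R + 1 <= n%:R ->
  (2 * (4 * n) ^ 4 * 3 ^ 9 * k0 ^ 8 <= q ^ 12)%N ->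
  (0 < k0)%N -> (3 * k0 <= n)%N -> (2 * (b * (14 * n)) < k0.+1 ^ 2)%N ->
  maker_wins_within (n := n) b (14 * n) set0 set0.
Proof.
move=> bnds k_gt0 q0 numq potq k0_gt0 k0n numB.
have n3 : (3 <= n)%N by apply: leq_trans k0n; rewrite -[3%N]muln1 leq_mul2l.
have -> : (14 * n = 12 * n + (n + n))%N by lia.
apply: (choice_stage (O := fun _ => set0) bnds k_gt0 q0 k0n numq); rewrite ?sub0set //.
- by move=> v; rewrite cards0.
- by move=> v w; rewrite inE.
- by under eq_bigr do rewrite cards0 subn0; rewrite sum_nat_const card_ord mulnC.
- move=> X sX cX; rewrite !set0U.
  have -> : (fun v : 'I_n => #|set0 : {set 'I_n}|) = (fun=> 0%N).
    by apply: funext => v; rewrite cards0.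
  by apply: danger_inv_init => //; apply: leqW.
- exact: conf_potential_init.
- move=> M' B' sB' cB' exM; have v0 : 'I_n by case: (n) n3 => // m _; apply: ord0.
  apply: (@connect_stage n b k0 n v0) => //; last by rewrite leq_addl.
  by rewrite cards0 in cB'; apply: leq_ltn_trans numB; lia.
Qed.

End OrderedFields.

(** * Numerical estimates *)

Delimit Scope R_scope with R.
Local Open Scope R_scope.

(* [1 + ln (j - 1)] bounds the harmonic sum [1 + 1/2 + ... + 1/(j - 1)]. *)
Definition harm_bound (j : nat) : R :=
  match j with
  | j'.+2 => 1 + ln (INR j'.+1)
  | _ => 0
  end.

Lemma ln_le_sub1 x : 0 < x -> ln x <= x - 1.
Proof.
move=> x0; have := exp_ineq1_le (ln x); rewrite exp_ln //; lra.
Qed.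

(** For [j = 1] both sides are 1; beyond, [ln x <= x - 1] is applied at [x = (j - 1) / j]. *)
Lemma harm_bound_step (j : nat) : (0 < j)%N -> harm_bound j + / INR j <= harm_bound j.+1.
Proof.
case: j => // -[|j] _; rewrite /harm_bound.
  by rewrite /= ln_1; lra.
have j0 : 0 < INR j.+1 by apply: lt_0_INR; lia.
have j1 : INR j.+2 = INR j.+1 + 1 by rewrite (S_INR j.+1).
have Eln : ln (INR j.+1 / INR j.+2) = ln (INR j.+1) - ln (INR j.+2).
  rewrite /Rdiv ln_mult ?ln_Rinv //; try apply: Rinv_0_lt_compat; lra.
have Esub : INR j.+1 / INR j.+2 - 1 = - / INR j.+2 by rewrite j1; field; lra.
have : ln (INR j.+1 / INR j.+2) <= INR j.+1 / INR j.+2 - 1.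
  by apply: ln_le_sub1; apply: Rdiv_lt_0_compat; lra.
lra.
Qed.

Lemma harm_bound_mono (i j : nat) : (0 < i <= j)%N -> harm_bound i <= harm_bound j.
Proof.
move=> /andP[i0]; elim: j => [|j IH]; first by lia.
rewrite leq_eqVlt => /orP[/eqP->|]; first exact: Rle_refl.
rewrite ltnS => ij; have j0 : (0 < j)%N by lia.
have := IH ij; have := harm_bound_step j0.
have : 0 < / INR j by apply: Rinv_0_lt_compat; apply: lt_0_INR; lia.
lra.
Qed.

Lemma nat_floor x : 0 <= x -> exists m : nat, INR m <= x < INR m + 1.
Proof.
move=> /RleP x0; have /andP[] := truncn_itv x0.
rewrite -!INRE => /RleP le1 /RltP lt2.
by exists (Num.truncn x); rewrite -S_INR.
Qed.

(** Here [t] is the fourth root of [ln N]. With [y = N / t], the bias bound gives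
    [b * t ^ 4 <= N - 30 * y], and each of the four other groups of terms is at most [y]. *)
Lemma bias_estimate (N t b : R) :
  3000 <= t -> N = exp (t ^ 4) -> 0 <= b -> b <= (1 - 30 / t) * (N / t ^ 4) ->
  (b + 1) * (25 + t ^ 4 + 4 * t) + N / t ^ 4 + N / t + 3 <= N.
Proof.
move=> t0 EN b0 leb.
have Nge : t ^ 8 / 4 <= N.
  rewrite EN; have -> : t ^ 4 = t ^ 4 / 2 + t ^ 4 / 2 by field.
  rewrite exp_plus.
  have e1 := exp_ineq1_le (t ^ 4 / 2).
  have t4 : 0 <= t ^ 4 by apply: pow_le; lra.
  have -> : t ^ 8 / 4 = (t ^ 4 / 2) * (t ^ 4 / 2) by field.
  by apply: Rmult_le_compat; lra.
set y := N / t; have ENy : N = y * t by rewrite /y; field; lra.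
have t4pos : 0 < t ^ 4 by apply: pow_lt; lra.
have t2 : 9000000 <= t ^ 2 by nra.
have t3 : 9000000 * t <= t ^ 3 by rewrite /= in t2 *; nra.
have y_ge : t ^ 7 / 4 <= y.
  apply: (Rmult_le_reg_r t); first lra.
  rewrite -ENy; have -> : t ^ 7 / 4 * t = t ^ 8 / 4 by field.
  exact: Nge.
have t7 : t ^ 4 * t ^ 3 = t ^ 7 by ring.
have y1 : t ^ 4 + 4 * t + 28 <= y by nra.
set z := N / t ^ 4 in leb *.
have Ez : z * t ^ 4 = N by rewrite /z; field; lra.
have Ez' : y = z * t ^ 3 by rewrite /y -Ez; field; lra.
have z0 : 0 <= z by nra.
have b1 : b * t ^ 4 <= N - 30 * y.
  have -> : N - 30 * y = (1 - 30 / t) * z * t ^ 4.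
    by rewrite Rmult_assoc Ez ENy; field; lra.
  by apply: Rmult_le_compat_r; lra.
have b2 : b <= z.
  apply: Rle_trans leb _.
  have : 0 < 30 / t by apply: Rdiv_lt_0_compat; lra.
  nra.
have b3 : b * (25 + 4 * t) <= y by rewrite Ez'; nra.
have z1 : z <= y by rewrite Ez'; nra.
by nra.
Qed.

(** Division by [(N / t) ^ 12] leaves [2 * 4 ^ 4 * 3 ^ 9 * 6 ^ 8 <= t ^ 4], which [3000 <= t]
    ensures. *)
Lemma potential_estimate (N t K Q : R) :
  3000 <= t -> 0 <= N -> 0 <= K <= 6 * N / t ^ 2 -> N / t <= Q ->
  2 * (4 * N) ^ 4 * 3 ^ 9 * K ^ 8 <= Q ^ 12.
Proof.
move=> t0 N0 KN QN; set y := N / t in QN.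
have ENy : N = y * t by rewrite /y; field; lra.
have y0 : 0 <= y by rewrite /y; apply: Rle_mult_inv_pos; lra.
apply: (Rle_trans _ (y ^ 12)); last by apply: pow_incr; lra.
have K8 := pow_incr _ _ 8 KN.
apply: (Rle_trans _ (2 * (4 * N) ^ 4 * 3 ^ 9 * (6 * N / t ^ 2) ^ 8)).
  apply: Rmult_le_compat_l => //.
  have : 0 <= (4 * N) ^ 4 by apply: pow_le; lra.
  lra.
have -> : 2 * (4 * N) ^ 4 * 3 ^ 9 * (6 * N / t ^ 2) ^ 8 =
    y ^ 12 * (2 * 4 ^ 4 * 3 ^ 9 * 6 ^ 8 / t ^ 4).
  by rewrite ENy; field; lra.
rewrite -[X in _ <= X]Rmult_1_r; apply: Rmult_le_compat_l; first exact: pow_le.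
have t4 : 3000 ^ 4 <= t ^ 4 by apply: pow_incr; lra.
have t4pos : 0 < t ^ 4 by lra.
apply: (Rmult_le_reg_r (t ^ 4)) => //.
have -> : 2 * 4 ^ 4 * 3 ^ 9 * 6 ^ 8 / t ^ 4 * t ^ 4 = 2 * 4 ^ 4 * 3 ^ 9 * 6 ^ 8.
  by field; lra.
lra.
Qed.

Definition avg_danger_bound (n b j : nat) : R :=
  2 * INR b * (1 + harm_bound n - harm_bound j).

(** Below [k] a step costs [b / j] instead of [2 * b / j]. With [k] near [n / ln n] the value at 1
    is therefore about [b * ln n], not twice that. *)
Definition avg_touching_bound (n b k j : nat) : R :=
  avg_danger_bound n b k + (INR k - INR j) +
  INR b * (harm_bound k - harm_bound j).

Lemma harm_danger_bounds (n b k : nat) : (0 < k <= n)%N ->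
  danger_bounds n b k (avg_danger_bound n b) (avg_touching_bound n b k).
Proof.
move=> /andP[k0 kn].
have b0 : 0 <= INR b by apply: pos_INR.
have hk (i j : nat) : (0 < i <= j)%N -> harm_bound i <= harm_bound j.
  exact: harm_bound_mono.
have I2 : INR 2 = 2 by rewrite /=; lra.
split.
- move=> j j0 _; apply/RleP; rewrite -?INRE -?RealsE I2.
  have := harm_bound_step j0; rewrite /avg_danger_bound; nra.
- move=> j /andP[j0 _]; apply/RleP; rewrite -?INRE -?RealsE.
  have := harm_bound_step j0; rewrite /avg_touching_bound S_INR; nra.
- by apply/RleP; rewrite /avg_touching_bound; lra.
- move=> j /andP[kj jn]; apply/RleP; rewrite -?INRE -?RealsE I2.
  have : harm_bound j <= harm_bound n by apply: hk; lia.
  rewrite /avg_danger_bound; nra.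
- move=> j /andP[j0 jk]; apply/RleP; rewrite -?INRE -?RealsE.
  have hjk : harm_bound j <= harm_bound k by apply: hk; lia.
  have hkn : harm_bound k <= harm_bound n by apply: hk; lia.
  have : INR j <= INR k by apply: le_INR; apply/ssrnat.leP.
  rewrite /avg_touching_bound /avg_danger_bound; nra.
Qed.

Lemma INR_muln (i j : nat) : INR (i * j)%N = INR i * INR j.
Proof. by rewrite !INRE natrM RealsE. Qed.

Lemma INR_expn (i j : nat) : INR (i ^ j)%N = INR i ^ j.
Proof. by rewrite !INRE natrX RpowE. Qed.

Lemma Rpower_root4 x : 0 < x -> Rpower x (1 / 4) ^ 4 = x.
Proof.
move=> x0; rewrite -Rpower_pow; last exact: exp_pos.
rewrite Rpower_mult; have -> : 1 / 4 * INR 4 = 1 by rewrite /=; field.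
exact: Rpower_1.
Qed.

Theorem theorem1 :
  exists n0 : nat, forall n b : nat,
    (n0 <= n)%N -> (0 < b)%N ->
    (INR b <= (1 - 30 / Rpower (ln (INR n)) (1/4)) * (INR n / ln (INR n)))%R ->
    maker_wins_within (n:=n) b (14 * n) set0 set0.
Proof.
(* The threshold gives [3000 ^ 4 <= ln n], that is [3000 <= t]. *)
have [m [_ ltm]] := nat_floor (Rlt_le _ _ (exp_pos (3000 ^ 4))).
exists m.+1 => n b le_n b0.
have leN : exp (3000 ^ 4) <= INR n.
  apply: Rlt_le; apply: Rlt_le_trans ltm _; rewrite -S_INR.
  by apply: le_INR; apply/ssrnat.leP.
set N := INR n in leN *; set L := ln N.
have N0 : 0 < N := Rlt_le_trans _ _ _ (exp_pos _) leN.
have geL : 3000 ^ 4 <= L.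
  rewrite -(ln_exp (3000 ^ 4)) /L; case: leN => [ltN|<-]; last exact: Rle_refl.
  by apply: Rlt_le; apply: ln_increasing => //; apply: exp_pos.
have L0 : 0 < L by lra.
set t := Rpower L (1 / 4).
have tL : t ^ 4 = L := Rpower_root4 L0.
have t_gt0 : 0 < t by apply: exp_pos.
have t0 : 3000 <= t.
  apply: Rnot_lt_le => lt_t.
  have t2 : 0 < t ^ 2 < 3000 ^ 2 by split; [apply: pow_lt | rewrite /=; nra].
  have Et : t ^ 4 = t ^ 2 * t ^ 2 by ring.
  by nra.
have EN : N = exp (t ^ 4) by rewrite tL /L exp_ln.
rewrite -tL => leb.
have est := bias_estimate t0 EN (pos_INR b) leb.
have [k0 [k0le k0gt]] : exists k0, INR k0 <= 6 * N / t ^ 2 < INR k0 + 1.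
  by apply: nat_floor; apply: Rle_mult_inv_pos; [lra | apply: pow_lt].
have [q' [q'le q'gt]] : exists q', INR q' <= N / t < INR q' + 1.
  by apply: nat_floor; apply: Rle_mult_inv_pos; lra.
(* The cutoff will be [k'.+2]: its [harm_bound] involves the logarithm of [k' + 1], which exceeds
   [N / L]. *)
have [k' [k'le k'gt]] : exists k', INR k' <= N / t ^ 4 < INR k' + 1.
  by apply: nat_floor; apply: Rle_mult_inv_pos; lra.
have lnL : ln L <= 4 * t.
  rewrite -tL ln_pow //; have -> : INR 4 = 4 by rewrite /=; lra.
  by have := ln_le_sub1 t_gt0; lra.
have z0 : 0 < N / t ^ 4 by apply: Rdiv_lt_0_compat; lra.
have b_ge1 : 1 <= INR b by apply: (le_INR 1); apply/ssrnat.leP.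
have y0 : 0 < N / t by apply: Rdiv_lt_0_compat; lra.
have kn : (k'.+2 <= n)%N.
  apply/ssrnat.leP; apply: INR_le; rewrite 2!S_INR -/N; nra.
have n2 : (2 <= n)%N by apply: leq_trans kn.
have hn : harm_bound n <= 1 + L.
  rewrite /L /N; case: (n) n2 => [|[|m']] // _; rewrite /harm_bound.
  have m'0 : 0 < INR m'.+1 by apply: lt_0_INR; lia.
  apply: Rplus_le_compat_l; apply: Rlt_le; apply: ln_increasing => //.
  by rewrite (S_INR m'.+1); lra.
have hk : 1 + L - ln L <= harm_bound k'.+2.
  rewrite /harm_bound.
  have -> : 1 + L - ln L = 1 + ln (N / L).
    by rewrite /Rdiv ln_mult ?ln_Rinv //; [rewrite /L; lra | apply: Rinv_0_lt_compat].
  apply: Rplus_le_compat_l; apply: Rlt_le; apply: ln_increasing.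
    by apply: Rdiv_lt_0_compat.
  by rewrite S_INR -tL; lra.
have Ew : 6 * N / t ^ 2 * t ^ 2 = 6 * N by field; lra.
have t2 : 9000000 <= t ^ 2 by rewrite /=; nra.
have Nt : t ^ 2 * t ^ 2 <= N.
  have -> : t ^ 2 * t ^ 2 = t ^ 4 by ring.
  nra.
have bnds := @harm_danger_bounds n b.+1 k'.+2 kn.
apply: (maker_wins_of_params (k := k'.+2) (q := q'.+1) (k0 := k0) bnds) => //.
(* With [H] for [harm_bound] and [k] for the cutoff, the coefficient of [b + 1] is
   [2 + 2 * H n - H k + 22], at most [25 + L + ln L]. The rest, [k - 1], [q] and 1, is at most
   [N / t ^ 4 + N / t + 3]. *)
- apply/RleP; rewrite -?INRE -?RealsE.
  have -> : INR 22 = 22 by rewrite /=; lra.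
  rewrite /avg_touching_bound /avg_danger_bound -[harm_bound 1]/0.
  have H1 := Rmult_le_compat_l _ _ _ (pos_INR b.+1) hn.
  have H2 := Rmult_le_compat_l _ _ _ (pos_INR b.+1) hk.
  have H3 := Rmult_le_compat_l _ _ _ (pos_INR b.+1) lnL.
  rewrite -/N -tL in H1 H2 H3 *.
  move: H1 H2 H3; rewrite (S_INR q') (S_INR k'.+1) (S_INR k') -[INR 1]/1 S_INR => *.
  nra.
- apply/ssrnat.leP; apply: INR_le; rewrite !(INR_muln, INR_expn).
  have -> : INR 2 = 2 by rewrite /=; lra.
  have -> : INR 3 = 3 by rewrite /=; lra.
  have -> : INR 4 = 4 by rewrite /=; lra.
  apply: (potential_estimate t0) => //; first exact: Rlt_le.
    by split; [apply: pos_INR | ].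
  by rewrite -/N S_INR; lra.
- apply/ssrnat.ltP; apply: INR_lt.
  rewrite -[INR 0]/0; nra.
- apply/ssrnat.leP; apply: INR_le; rewrite INR_muln -/N.
  have -> : INR 3 = 3 by rewrite /=; lra.
  nra.
- apply/ssrnat.ltP; apply: INR_lt; rewrite INR_expn !INR_muln -/N (S_INR k0).
  have -> : INR 2 = 2 by rewrite /=; lra.
  have -> : INR 14 = 14 by rewrite /=; lra.
  have bz : INR b <= N / t ^ 4.
    apply: Rle_trans leb _; have : 0 < 30 / t by apply: Rdiv_lt_0_compat; lra.
    nra.
  (* The left side is [28 * b * N], at most [36 * N ^ 2 / t ^ 4]; this is where the 6 in [k0] comes
     from. *)
  apply: (Rle_lt_trans _ ((6 * N / t ^ 2) ^ 2)).
    have -> : (6 * N / t ^ 2) ^ 2 = 36 * (N / t ^ 4 * N) by field; lra.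
    nra.
  have : 0 < 6 * N / t ^ 2 by apply: Rdiv_lt_0_compat; [lra | apply: pow_lt].
  move: (6 * N / t ^ 2) k0gt => w k0gt w0.
  by rewrite -!Rsqr_pow2; apply: Rsqr_incrst_1; lra.
Qed.
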